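(* There is only one orbit of generic 3-forms in $\wedge^3(\mathbb{C}^7)^*$ under the action of $\mathrm{GL}_7(\mathbb{C})$. A representative is $$\Omega_0=-2\big(E_0^*\wedge E_1^*\wedge F_1^*+E_0^*\wedge E_2^*\wedge F_2^*+E_0^*\wedge E_3^*\wedge F_3^*\big)-4\,E_1^*\wedge E_2^*\wedge E_3^*+4\,F_1^*\wedge F_2^*\wedge F_3^*.$$
   Context: $\{E_0,E_1,E_2,E_3,F_1,F_2,F_3\}$ denotes the canonical basis of $\mathbb{C}^7$ (in this order) and $\{E_0^*,\dots,F_3^*\}$ its dual basis. The group $\mathrm{GL}_7(\mathbb{C})$ acts on $\wedge^3(\mathbb{C}^7)^*$ by $(f\cdot\Omega)(X,Y,Z)=\Omega(f^{-1}(X),f^{-1}(Y),f^{-1}(Z))$. A 3-form $\Omega$ is called generic when its orbit under this action is open in $\wedge^3(\mathbb{C}^7)^*$ (equivalently, the stabilizer $G_\Omega=\{f:f\cdot\Omega=\Omega\}$ has dimension $49-35=14$). *)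

(* Defs.v *)
From mathcomp Require Export all_boot all_order all_algebra.
From mathcomp Require Export complex.
From mathcomp Require Export boolp classical_sets reals topology normedtype.

Export Order.TTheory GRing.Theory Num.Theory numFieldNormedType.Exports.
(* function spaces carry the product topology (pointwise convergence) *)
Export ArrowAsProduct.

Set Implicit Arguments.
Unset Strict Implicit.
Unset Printing Implicit Defensive.

Local Open Scope classical_set_scope.
Local Open Scope ring_scope.

Section ThreeForms.
Variable R : realType.

(* [R[i]^o] is [R[i]] seen as a module over itself; this is the alias on which
   MathComp-Analysis puts the topology given by the modulus. *)
Local Notation C := (R[i]^o).
Local Notation V := 'cV[R[i]]_7.

Definition trilinear (Omega : V -> V -> V -> C) : Prop :=
  [/\ forall Y Z, linear (fun X => Omega X Y Z),
      forall X Z, linear (fun Y => Omega X Y Z) &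
      forall X Y, linear (fun Z => Omega X Y Z)].

Definition alternating (Omega : V -> V -> V -> C) : Prop :=
  forall X Y Z, X = Y \/ Y = Z \/ X = Z -> Omega X Y Z = 0.

Definition form3 : set (V -> V -> V -> C) :=
  [set Omega | trilinear Omega /\ alternating Omega].

(* [f : 'M_7] acts on column vectors by [X |-> f *m X]; it is only used for
   [f \in unitmx], i.e. [f] in GL_7(C). *)
Definition act (f : 'M[R[i]]_7) (Omega : V -> V -> V -> C) : V -> V -> V -> C :=
  fun X Y Z => Omega (invmx f *m X) (invmx f *m Y) (invmx f *m Z).

Definition orbit3 (Omega : V -> V -> V -> C) : set (V -> V -> V -> C) :=
  [set act f Omega | f in [set f | f \in unitmx]].

(* The orbit is open in the space of 3-forms with its subspace topology: on
   this finite-dimensional space of trilinear maps, pointwise convergence is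
   convergence of the coefficients, i.e. the usual topology. *)
Definition generic3 : set (V -> V -> V -> C) :=
  [set Omega | form3 Omega /\ open (orbit3 Omega : set (subspace form3))].

(* [e1 /\ e2 /\ e3], normalized by
   (e1 /\ e2 /\ e3)(X1, X2, X3) = det (e_i(X_j)). *)
Definition wedge3 (e1 e2 e3 : V -> C) : V -> V -> V -> C :=
  fun X Y Z => \det (\matrix_(i < 3, j < 3)
    (tnth [tuple e1; e2; e3] i (tnth [tuple X; Y; Z] j) : R[i])).

(* The canonical basis is ordered as E_0, E_1, E_2, E_3, F_1, F_2, F_3:
   [dualE k] is E_k^* for k <= 3 and [dualF k] is F_k^* for 1 <= k <= 3. *)
Definition dualE (k : nat) : V -> C := fun X => X (inord k) ord0.
Definition dualF (k : nat) : V -> C := fun X => X (inord (3 + k)) ord0.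

Definition Omega0 : V -> V -> V -> C := fun X Y Z =>
  - 2%:R * (wedge3 (dualE 0) (dualE 1) (dualF 1) X Y Z
            + wedge3 (dualE 0) (dualE 2) (dualF 2) X Y Z
            + wedge3 (dualE 0) (dualE 3) (dualF 3) X Y Z)
  - 4%:R * wedge3 (dualE 1) (dualE 2) (dualE 3) X Y Z
  + 4%:R * wedge3 (dualF 1) (dualF 2) (dualF 3) X Y Z.

End ThreeForms.

Arguments Omega0 : clear implicits.
Arguments form3 : clear implicits.
Arguments generic3 : clear implicits.

(* Main.v *)
From HB Require Import structures.
Require Import Defs.
From mathcomp Require Import ring.

Set Implicit Arguments.
Unset Strict Implicit.
Unset Printing Implicit Defensive.

Local Open Scope classical_set_scope.
Local Open Scope ring_scope.

(** Write the basis as e_0, ..., e_6 = E_0, E_1, E_2, E_3, F_1, F_2, F_3, let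
    e^abd be the wedge product of the dual vectors, and
    w_abd = Omega(e_a, e_b, e_d). The form
      Phi0 = e^014 + e^025 + e^036 + e^123 + e^156 - e^246 + e^345
    is reached, except for its coefficients at e^156, e^246, e^345, e^456, by
    rational pivoting: make the 2-form Omega(E_0, ., .) standard on <E_i, F_i>,
    then, using w_123 as pivot, kill the coefficients [E_i E_j F_k]; then
    diagonalize the 3 x 3 matrix of the coefficients [E_i F_j F_k]. Each stage
    only needs one coefficient to be nonzero, is continuous at Phi0, and fixes
    Phi0. There remain the coefficients q_1, q_2, q_3, d of e^156, - e^246,
    e^345, e^456; after a rescaling this is a binary cubic, and when
    q_1 q_2 q_3 (d^2 + 4 q_1 q_2 q_3) is nonzero it is a sum of two cubes, which
    gives Omega0.

    Hence all forms close to Phi0 lie in the orbit of Omega0, so that this orbit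
    is open. Conversely, in an open orbit one can move a little from Omega
    towards Phi0, which preserves the coefficients already normalized and makes
    the next pivot nonzero, and then pivot; so an open orbit contains Omega0. *)

Local Notation "w '_[' a , b , d ]" := (w a%N b%N d%N)
  (at level 1, left associativity, only parsing).

(** * Normalizing the coefficients *)

Section Coefficients.
Variable F : numFieldType.
Definition coefs := nat -> nat -> nat -> F.

Definition alt_coefs (w : coefs) : Prop :=
  [/\ forall a b d, w a b d = - w b a d, forall a b d, w a b d = - w a d b,
      forall a b, w a a b = 0 & forall a b, w a b b = 0].

(* The move (i, j, y) replaces e_i by e_i + y e_j; for i = j it is the scaling
   by 1 + y. *)
Definition subst_index (i j : nat) (y : F) (a : nat) (f : nat -> F) : F :=
  if eqn a i then f a + y * f j else f a.

Definition elem_coefs (o : nat * nat * F) (w : coefs) : coefs := fun a b d =>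
  let: (i, j, y) := o in
  subst_index i j y a (fun a' => subst_index i j y b (fun b' =>
    subst_index i j y d (fun d' => w a' b' d'))).

Definition run_coefs (s : seq (nat * nat * F)) (w : coefs) : coefs :=
  foldl (fun w o => elem_coefs o w) w s.

Definition op (i j : nat) (x : coefs -> F) := (i, j, x).

(** All scalars of a stage are read off the coefficients at the start of the stage, not after its
    earlier moves. *)
Definition ops_at (L : seq (nat * nat * (coefs -> F))) (w : coefs) :=
  [seq (p.1, p.2 w) | p <- L].

(** A nested conjunction, so that for a concrete [T] it unfolds to explicit equations. *)
Definition slice (phi : coefs) (T : seq (nat * nat * nat)) (w : coefs) : Prop :=
  foldr (fun t P => w t.1.1 t.1.2 t.2 = phi t.1.1 t.1.2 t.2 /\ P) True T.

(** Every pivot of the stages is 1 or -1 here, whereas Omega0 has coefficient 0 at the pivots e^156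
    and e^246. Only increasing triples matter: the table is 0 elsewhere, hence not alternating. *)
Definition phi0 : coefs := fun a b d =>
  match a, b, d with
  | 0%N, 1%N, 4%N | 0%N, 2%N, 5%N | 0%N, 3%N, 6%N
  | 1%N, 2%N, 3%N | 1%N, 5%N, 6%N | 3%N, 4%N, 5%N => 1
  | 2%N, 4%N, 6%N => -1
  | _, _, _ => 0
  end.

(* The sets of triples on which the coefficients agree with phi0 after the
   first, second, ... stage of the reduction. *)
Definition fixed1 := [:: (0, 1, 4)]%N.
Definition fixed2 := fixed1 ++ [:: (0, 1, 2); (0, 1, 3); (0, 1, 5); (0, 1, 6);
  (0, 2, 4); (0, 3, 4); (0, 4, 5); (0, 4, 6)]%N.
Definition fixed3 := fixed2 ++ [:: (0, 2, 5)]%N.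
Definition fixed4 := fixed3 ++ [:: (0, 2, 3); (0, 2, 6); (0, 3, 5); (0, 5, 6)]%N.
Definition fixed5 := fixed4 ++ [:: (0, 3, 6)]%N.
Definition fixed6 := fixed5 ++ [:: (1, 2, 3)]%N.
Definition fixed7 := fixed6 ++ [:: (1, 2, 4); (1, 2, 5); (1, 2, 6); (1, 3, 4);
  (1, 3, 5); (1, 3, 6); (2, 3, 4); (2, 3, 5); (2, 3, 6)]%N.
Definition fixed8 := fixed7 ++ [:: (1, 4, 5); (1, 4, 6); (2, 5, 6); (3, 5, 6)]%N.
Definition fixed9 := fixed8 ++ [:: (2, 4, 5); (3, 4, 6)]%N.

Definition moves1 := [:: op 4 4 (fun w => w _[0, 1, 4]^-1 - 1)].
(** Symplectic Gram-Schmidt for Omega(E_0, ., .): the other E_i and F_i are made orthogonal to the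
    hyperbolic pair E_1, F_1. [moves4] does the same with E_2, F_2. *)
Definition moves2 :=
  [:: op 2 1 (fun w => - w _[0, 2, 4]); op 2 4 (fun w => - w _[0, 1, 2]);
      op 3 1 (fun w => - w _[0, 3, 4]); op 3 4 (fun w => - w _[0, 1, 3]);
      op 5 1 (fun w => w _[0, 4, 5]); op 5 4 (fun w => - w _[0, 1, 5]);
      op 6 1 (fun w => w _[0, 4, 6]); op 6 4 (fun w => - w _[0, 1, 6])].
Definition moves3 := [:: op 5 5 (fun w => w _[0, 2, 5]^-1 - 1)].
Definition moves4 :=
  [:: op 3 2 (fun w => - w _[0, 3, 5]); op 3 5 (fun w => - w _[0, 2, 3]);
      op 6 2 (fun w => w _[0, 5, 6]); op 6 5 (fun w => - w _[0, 2, 6])].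
Definition moves5 := [:: op 6 6 (fun w => w _[0, 3, 6]^-1 - 1)].
(** The inverse scalings of E_1 and F_1 preserve w_014 = 1. *)
Definition moves6 := [:: op 1 1 (fun w => w _[1, 2, 3]^-1 - 1);
                     op 4 4 (fun w => w _[1, 2, 3] - 1)].

(* Let P_lk = [E_i E_j F_k] with (i, j, l) a cyclic permutation of (1, 2, 3).
   Adding multiples of E_0 to the E_i changes the skew part of P; adding a
   symmetric combination of the E_l to the F_k changes its symmetric part and
   keeps the 2-form Omega(E_0, ., .). *)
Definition moves7 :=
  [:: op 1 0 (fun w => 2^-1 * (- w _[1, 3, 6] - w _[1, 2, 5]));
      op 2 0 (fun w => 2^-1 * (w _[1, 2, 4] - w _[2, 3, 6]));
      op 3 0 (fun w => 2^-1 * (w _[2, 3, 5] + w _[1, 3, 4]));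
      op 4 1 (fun w => - w _[2, 3, 4]);
      op 5 2 (fun w => w _[1, 3, 5]);
      op 6 3 (fun w => - w _[1, 2, 6]);
      op 4 2 (fun w => - 2^-1 * (w _[2, 3, 5] - w _[1, 3, 4]));
      op 5 1 (fun w => - 2^-1 * (w _[2, 3, 5] - w _[1, 3, 4]));
      op 4 3 (fun w => - 2^-1 * (w _[2, 3, 6] + w _[1, 2, 4]));
      op 6 1 (fun w => - 2^-1 * (w _[2, 3, 6] + w _[1, 2, 4]));
      op 5 3 (fun w => - 2^-1 * (w _[1, 2, 5] - w _[1, 3, 6]));
      op 6 2 (fun w => - 2^-1 * (w _[1, 2, 5] - w _[1, 3, 6]))].

(* Let Q_il = [E_i F_j F_k] with (j, k, l) cyclic. Adding multiples of E_0 to the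
   F_j makes Q symmetric, after which Q is diagonalized by moves on the E_i with
   the contragredient moves on the F_j. *)
Definition moves8 :=
  [:: op 5 0 (fun w => 2^-1 * (w _[3, 5, 6] - w _[1, 4, 5]));
      op 6 0 (fun w => 2^-1 * (- w _[1, 4, 6] - w _[2, 5, 6]));
      op 2 1 (fun w => - 2^-1 * (w _[2, 5, 6] - w _[1, 4, 6]) * w _[1, 5, 6]^-1);
      op 3 1 (fun w => - 2^-1 * (w _[3, 5, 6] + w _[1, 4, 5]) * w _[1, 5, 6]^-1);
      op 4 5 (fun w => 2^-1 * (w _[2, 5, 6] - w _[1, 4, 6]) * w _[1, 5, 6]^-1);
      op 4 6 (fun w => 2^-1 * (w _[3, 5, 6] + w _[1, 4, 5]) * w _[1, 5, 6]^-1)].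

(** The same for the remaining 2 x 2 block of Q, with pivot w_246, which is minus its first diagonal
    entry. *)
Definition moves9 :=
  [:: op 4 0 (fun w => 2^-1 * (w _[2, 4, 5] + w _[3, 4, 6]));
      op 3 2 (fun w => 2^-1 * (w _[2, 4, 5] - w _[3, 4, 6]) * w _[2, 4, 6]^-1);
      op 5 6 (fun w => - 2^-1 * (w _[2, 4, 5] - w _[3, 4, 6]) * w _[2, 4, 6]^-1)].
End Coefficients.

Ltac sort_coefs w A12 A23 A0 A1 :=
  repeat match goal with
  | |- context [w ?a ?b ?d] =>
    let e := eval compute in (eqn a b) in
    match e with true => rewrite (A0 a d) end
  | |- context [w ?a ?b ?d] =>
    let e := eval compute in (eqn b d) in
    match e with true => rewrite (A1 a b) end
  | |- context [w ?a ?b ?d] =>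
    let t := eval compute in (ltn b a) in
    match t with true => rewrite (A12 a b d) end
  | |- context [w ?a ?b ?d] =>
    let t := eval compute in (ltn d b) in
    match t with true => rewrite (A23 a b d) end
  end.
Ltac unfold_step := cbv beta iota zeta delta [slice fixed1 fixed2
  fixed3 fixed4 fixed5 fixed6 fixed7 fixed8 fixed9 cat foldr fst snd phi0
  ops_at map op moves1 moves2 moves3 moves4 moves5 moves6 moves7 moves8 moves9
  run_coefs foldl elem_coefs subst_index eqn].
(** Once indices are sorted and known coefficients substituted, each equation of a stage is an
    identity of rational functions whose only denominators are the pivot and numerals. *)
Ltac run_step w :=
  let A12 := fresh in let A23 := fresh in let A0 := fresh in let A1 := fresh in
  let H := fresh in
  case=> A12 A23 A0 A1; unfold_step; intros H; decompose [and] H; clear H;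
  repeat split;
  sort_coefs w A12 A23 A0 A1;
  repeat match goal with
  | E : w ?a ?b ?d = _ |- context [w ?a ?b ?d] => rewrite !E end;
  try (field; repeat (apply/andP; split); by rewrite ?pnatr_eq0).

Section Stages.
Variable F : numFieldType.
Local Notation stage T L T' := (forall w : coefs F,
  alt_coefs w -> slice (@phi0 F) T w ->
  slice (@phi0 F) T' (run_coefs (ops_at (L F) w) w)).
Local Notation pivot_stage T L T' a b d := (forall w : coefs F,
  w _[a, b, d] != 0 -> alt_coefs w -> slice (@phi0 F) T w ->
  slice (@phi0 F) T' (run_coefs (ops_at (L F) w) w)).

Lemma step1 : pivot_stage [::] moves1 fixed1 0 1 4.
Proof. move=> w p; run_step w. Qed.

Lemma step2 : stage fixed1 moves2 fixed2.
Proof. move=> w; run_step w. Qed.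

Lemma step3 : pivot_stage fixed2 moves3 fixed3 0 2 5.
Proof. move=> w p; run_step w. Qed.

Lemma step4 : stage fixed3 moves4 fixed4.
Proof. move=> w; run_step w. Qed.

Lemma step5 : pivot_stage fixed4 moves5 fixed5 0 3 6.
Proof. move=> w p; run_step w. Qed.

Lemma step6 : pivot_stage fixed5 moves6 fixed6 1 2 3.
Proof. move=> w p; run_step w. Qed.

Lemma step7 : stage fixed6 moves7 fixed7.
Proof. move=> w; run_step w. Qed.

Lemma step8 : pivot_stage fixed7 moves8 fixed8 1 5 6.
Proof. move=> w p; run_step w. Qed.

Lemma step9 : pivot_stage fixed8 moves9 fixed9 2 4 6.
Proof. move=> w p; run_step w. Qed.
End Stages.

(** * Splitting the binary cubic into two cubes *)

Definition split_coefs (F : numFieldType) (x y z : F) : coefs F := fun a b d =>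
  match a, b, d with
  | 0%N, 1%N, 4%N | 0%N, 2%N, 5%N | 0%N, 3%N, 6%N => x
  | 1%N, 2%N, 3%N => y
  | 4%N, 5%N, 6%N => z
  | _, _, _ => 0
  end.

Definition all_triples := [:: (0, 1, 2); (0, 1, 3); (0, 1, 4); (0, 1, 5); (0, 1, 6);
  (0, 2, 3); (0, 2, 4); (0, 2, 5); (0, 2, 6); (0, 3, 4); (0, 3, 5); (0, 3, 6);
  (0, 4, 5); (0, 4, 6); (0, 5, 6); (1, 2, 3); (1, 2, 4); (1, 2, 5); (1, 2, 6);
  (1, 3, 4); (1, 3, 5); (1, 3, 6); (1, 4, 5); (1, 4, 6); (1, 5, 6); (2, 3, 4);
  (2, 3, 5); (2, 3, 6); (2, 4, 5); (2, 4, 6); (2, 5, 6); (3, 4, 5); (3, 4, 6);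
  (3, 5, 6); (4, 5, 6)]%N.

(* The new basis is (t / r_i) E_i - r_i F_i, (s / r_i) E_i - r_i F_i. *)
Definition split_ops (F : numFieldType) (r1 r2 r3 s t : F) :
    seq (nat * nat * F) :=
  [:: (1%N, 1%N, t / r1 - 1); (4%N, 4%N, - r1 - 1); (1%N, 4%N, 1);
      (4%N, 4%N, 1 - s / t - 1); (4%N, 1%N, s / t);
      (2%N, 2%N, t / r2 - 1); (5%N, 5%N, - r2 - 1); (2%N, 5%N, 1);
      (5%N, 5%N, 1 - s / t - 1); (5%N, 2%N, s / t);
      (3%N, 3%N, t / r3 - 1); (6%N, 6%N, - r3 - 1); (3%N, 6%N, 1);
      (6%N, 6%N, 1 - s / t - 1); (6%N, 3%N, s / t)].

Definition scale_ops (F : numFieldType) (k c c' : F) : seq (nat * nat * F) :=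
  [:: (0%N, 0%N, k - 1); (1%N, 1%N, c - 1); (2%N, 2%N, c - 1);
      (3%N, 3%N, c - 1); (4%N, 4%N, c' - 1); (5%N, 5%N, c' - 1);
      (6%N, 6%N, c' - 1)].

(** On the vectors v_i(x_i) = (x_i / r_i) E_i - r_i F_i the form is 1 / (r1 r2 r3) times x_1 x_2 x_3
    - s t (x_1 + x_2 + x_3) + s t (s + t), the polarization of a binary cubic. Its Hessian has the
    roots s and t, so it vanishes when both s and t occur among the x_i; only the two cubes
    remain. *)
Lemma step_split (F : numFieldType) (w : coefs F) (r1 r2 r3 s t : F) :
  r1 != 0 -> r2 != 0 -> r3 != 0 -> t != 0 ->
  s = - (r1 * r2 * r3) ^+ 2 / t -> alt_coefs w ->
  slice (@phi0 F) fixed9 w /\ w _[1, 5, 6] = r1 ^+ 2 /\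
  w _[2, 4, 6] = - r2 ^+ 2 /\ w _[3, 4, 5] = r3 ^+ 2 /\
  w _[4, 5, 6] = s + t ->
  slice (split_coefs (s - t) (t * (t - s) ^+ 2 / (r1 * r2 * r3))
           (s * (t - s) ^+ 2 / (r1 * r2 * r3)))
    all_triples (run_coefs (split_ops r1 r2 r3 s t) w).
Proof.
move=> n1 n2 n3 nt -> [A12 A23 A0 A1].
cbv beta iota zeta delta [slice all_triples fixed1 fixed2 fixed3 fixed4
  fixed5 fixed6 fixed7 fixed8 fixed9 split_coefs split_ops cat foldr fst snd phi0
  run_coefs foldl elem_coefs subst_index eqn].
move=> H; decompose [and] H; clear H.
repeat split;
  sort_coefs w A12 A23 A0 A1;
  repeat match goal with
  | E : w ?a ?b ?d = _ |- context [w ?a ?b ?d] => rewrite !E end.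
all: field.
all: by rewrite ?n1 ?n2 ?n3 ?nt.
Qed.

Lemma step_scale (F : numFieldType) (w : coefs F) (k c c' x y z : F) :
  alt_coefs w -> slice (split_coefs x y z) all_triples w ->
  slice (split_coefs (k * c * c' * x) (c ^+ 3 * y) (c' ^+ 3 * z)) all_triples
    (run_coefs (scale_ops k c c') w).
Proof.
move=> [A12 A23 A0 A1].
cbv beta iota zeta delta [slice all_triples split_coefs scale_ops
  cat foldr fst snd run_coefs foldl elem_coefs subst_index eqn].
move=> H; decompose [and] H; clear H.
repeat split;
  sort_coefs w A12 A23 A0 A1;
  repeat match goal with
  | E : w ?a ?b ?d = _ |- context [w ?a ?b ?d] => rewrite !E end.
all: ring.
Qed.

(** * Trilinear alternating forms *)

Lemma det_mx33 (F : comNzRingType) (M : 'M[F]_3) :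
  let m a b := M (inord a) (inord b) in
  \det M = m 0%N 0%N * (m 1%N 1%N * m 2%N 2%N - m 1%N 2%N * m 2%N 1%N)
         - m 0%N 1%N * (m 1%N 0%N * m 2%N 2%N - m 1%N 2%N * m 2%N 0%N)
         + m 0%N 2%N * (m 1%N 0%N * m 2%N 1%N - m 1%N 1%N * m 2%N 0%N).
Proof.
move=> m; have mE a b : M a b = m a b by rewrite /m !inord_val.
rewrite (expand_det_row _ ord0) !big_ord_recl big_ord0 /cofactor.
rewrite !(expand_det_row _ ord0) !big_ord_recl !big_ord0 /cofactor.
by rewrite !det_mx11 !mxE !mE /= /bump /= !expr0 !expr1 ?expr2; ring.
Qed.

Section Forms.
Variable R : realType.
Local Notation K := R[i].
Local Notation C := (R[i]^o).
Local Notation V := 'cV[R[i]]_7.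
Local Notation form := (V -> V -> V -> C).
Implicit Types Omega Psi : form.

Lemma form_funext Omega Psi :
  (forall X Y Z, Omega X Y Z = Psi X Y Z) -> Omega = Psi.
Proof. by move=> e; do 3 apply: funext => ?; exact: e. Qed.

(* Meaningful for a < 7 only, as inord is constant beyond that. *)
Definition basis (a : nat) : V := delta_mx (inord a) ord0.

Definition coef Omega : coefs K := fun a b d =>
  Omega (basis a) (basis b) (basis d).

Lemma form3_lin1 Omega (a : K) X X' Y Z : form3 R Omega ->
  Omega (X + a *: X') Y Z = Omega X Y Z + a * Omega X' Y Z.
Proof. by move=> [[h _ _] _]; rewrite addrC (h Y Z a X' X) addrC. Qed.

Lemma form3_lin2 Omega (a : K) X Y Y' Z : form3 R Omega ->
  Omega X (Y + a *: Y') Z = Omega X Y Z + a * Omega X Y' Z.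
Proof. by move=> [[_ h _] _]; rewrite addrC (h X Z a Y' Y) addrC. Qed.

Lemma form3_lin3 Omega (a : K) X Y Z Z' : form3 R Omega ->
  Omega X Y (Z + a *: Z') = Omega X Y Z + a * Omega X Y Z'.
Proof. by move=> [[_ _ h] _]; rewrite addrC (h X Y a Z' Z) addrC. Qed.

Lemma form3_diag Omega X Y : form3 R Omega ->
  [/\ Omega X X Y = 0, Omega X Y Y = 0 & Omega X Y X = 0].
Proof. by move=> [_ h]; split; apply: h; auto. Qed.

Lemma form3_swap12 Omega X Y Z : form3 R Omega -> Omega X Y Z = - Omega Y X Z.
Proof.
move=> h; have [e _ _] := form3_diag (X + 1 *: Y) Z h.
move: e; rewrite (form3_lin1 _ _ _ _ _ h) !(form3_lin2 _ _ _ _ _ h).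
have [-> _ _] := form3_diag X Z h; have [-> _ _] := form3_diag Y Z h.
by rewrite !mul1r addr0 add0r => /eqP; rewrite addr_eq0 => /eqP.
Qed.

Lemma form3_swap23 Omega X Y Z : form3 R Omega -> Omega X Y Z = - Omega X Z Y.
Proof.
move=> h; have [_ e _] := form3_diag X (Y + 1 *: Z) h.
move: e; rewrite (form3_lin2 _ _ _ _ _ h) !(form3_lin3 _ _ _ _ _ h).
have [_ -> _] := form3_diag X Y h; have [_ -> _] := form3_diag X Z h.
by rewrite !mul1r addr0 add0r => /eqP; rewrite addr_eq0 => /eqP.
Qed.

Lemma coef_alt Omega : form3 R Omega -> alt_coefs (coef Omega).
Proof.
move=> h; split=> a b; rewrite /coef.
- by move=> d; exact: form3_swap12.
- by move=> d; exact: form3_swap23.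
- by have [] := form3_diag (basis a) (basis b) h.
- by have [] := form3_diag (basis a) (basis b) h.
Qed.

Lemma form3_comb Omega Psi (a : K) : form3 R Omega -> form3 R Psi ->
  form3 R (fun X Y Z => Omega X Y Z + a * Psi X Y Z).
Proof.
move=> [[h1 h2 h3] h4] [[k1 k2 k3] k4]; split; first split.
- by move=> Y Z c X X'; rewrite h1 k1 /GRing.scale /=; ring.
- by move=> X Z c Y Y'; rewrite h2 k2 /GRing.scale /=; ring.
- by move=> X Y c Z Z'; rewrite h3 k3 /GRing.scale /=; ring.
- by move=> X Y Z e; rewrite h4 // k4 // mulr0 addr0.
Qed.

Lemma form3_act f Omega : form3 R Omega -> form3 R (act f Omega).
Proof.
move=> [[h1 h2 h3] h4]; split; first split.
- by move=> Y Z c X X'; rewrite /act mulmxDr -scalemxAr h1.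
- by move=> X Z c Y Y'; rewrite /act mulmxDr -scalemxAr h2.
- by move=> X Y c Z Z'; rewrite /act mulmxDr -scalemxAr h3.
- by move=> X Y Z e; apply: h4; case: e => [->|[->|->]]; auto.
Qed.

Lemma wedge3E (e1 e2 e3 : V -> C) X Y Z : wedge3 e1 e2 e3 X Y Z =
  e1 X * (e2 Y * e3 Z - e2 Z * e3 Y) - e1 Y * (e2 X * e3 Z - e2 Z * e3 X)
  + e1 Z * (e2 X * e3 Y - e2 Y * e3 X).
Proof.
rewrite /wedge3 det_mx33 /= !mxE !(tnth_nth e1) !(tnth_nth X) /=.
by rewrite !inordK.
Qed.

Lemma form3_wedge (e1 e2 e3 : V -> C) : linear e1 -> linear e2 -> linear e3 ->
  form3 R (wedge3 e1 e2 e3).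
Proof.
move=> l1 l2 l3; split; first split.
- by move=> Y Z c X X'; rewrite !wedge3E l1 l2 l3 /GRing.scale /=; ring.
- by move=> Y Z c X X'; rewrite !wedge3E l1 l2 l3 /GRing.scale /=; ring.
- by move=> Y Z c X X'; rewrite !wedge3E l1 l2 l3 /GRing.scale /=; ring.
- by move=> X Y Z [->|[->|->]]; rewrite !wedge3E; ring.
Qed.

Lemma form3_ext Omega Psi : form3 R Omega -> form3 R Psi ->
  (forall a b d, (a < 7)%N -> (b < 7)%N -> (d < 7)%N ->
    coef Omega a b d = coef Psi a b d) ->
  Omega = Psi.
Proof.
move=> hO hP.
have sumE (X : V) : X = \sum_(i < 7) X i ord0 *: basis i.
  rewrite {1}[X]matrix_sum_delta; apply: eq_bigr => i _.
  by rewrite big_ord1 /basis inord_val.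
have ext (f g : V -> C) : linear f -> linear g ->
    (forall i, (i < 7)%N -> f (basis i) = g (basis i)) -> f = g.
  move=> lf lg e; apply: funext => X.
  pose f' := GRing.isLinear.Build _ _ _ _ f lf.
  pose g' := GRing.isLinear.Build _ _ _ _ g lg.
  pose ff : {linear V -> C} := HB.pack f f'.
  pose gg : {linear V -> C} := HB.pack g g'.
  rewrite (sumE X) -[f]/(ff : V -> C) -[g]/(gg : V -> C) !linear_sum.
  by apply: eq_bigr => i _; rewrite !linearZ /= /ff /gg /= e.
case: hO hP => [[h1 h2 h3] _] [[k1 k2 k3] _] e.
(* The arguments are extended from basis vectors to all vectors one at a time, the last one
   first. *)
have e1 a b : (a < 7)%N -> (b < 7)%N ->
    Omega (basis a) (basis b) = Psi (basis a) (basis b).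
  by move=> la lb; apply: ext => // d ld; apply: e.
have e2 a Z : (a < 7)%N -> Omega (basis a) ^~ Z = Psi (basis a) ^~ Z.
  by move=> la; apply: ext => // b lb; rewrite e1.
apply: form_funext => X Y Z.
have := ext _ _ (h1 Y Z) (k1 Y Z) => /(_ _)/(f_equal (fun f => f X)); apply.
by move=> a la; have /(f_equal (fun f => f Y)) := e2 a Z la.
Qed.
End Forms.

(** * Orbits and elementary moves *)

Section Orbits.
Variable R : realType.
Local Notation K := R[i].
Local Notation C := (R[i]^o).
Local Notation V := 'cV[R[i]]_7.
Local Notation form := (V -> V -> V -> C).
Implicit Types Omega Psi : form.

Lemma orbit3_refl Omega : orbit3 Omega Omega.
Proof.
exists 1%:M; first by rewrite /= unitmx1.
by apply: form_funext => X Y Z; rewrite /act invmx1 !mul1mx.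
Qed.

Lemma act_mulmx (f g : 'M[K]_7) Omega : f \in unitmx -> g \in unitmx ->
  act f (act g Omega) = act (f *m g) Omega.
Proof.
move=> uf ug; apply: form_funext => X Y Z.
have e : invmx (f *m g) = invmx g *m invmx f.
  have := @invrM 'M[K]_7 f g; rewrite !mulmxE; exact.
by rewrite /act e !mulmxA.
Qed.

Lemma orbit3_sym Omega Psi : orbit3 Omega Psi -> orbit3 Psi Omega.
Proof.
move=> [f /= uf <-]; exists (invmx f); first by rewrite /= unitmx_inv.
rewrite act_mulmx ?unitmx_inv // mulVmx //.
by apply: form_funext => X Y Z; rewrite /act invmx1 !mul1mx.
Qed.

Lemma orbit3_trans Omega Psi Xi : orbit3 Omega Psi -> orbit3 Psi Xi ->
  orbit3 Omega Xi.
Proof.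
move=> [f /= uf <-] [g /= ug <-]; exists (g *m f).
  by rewrite /= unitmx_mul ug.
by rewrite act_mulmx.
Qed.

Lemma orbit3_eq Omega Psi : orbit3 Omega Psi -> orbit3 Omega = orbit3 Psi.
Proof.
move=> h; apply/seteqP; split => Xi; apply: orbit3_trans => //; exact: orbit3_sym.
Qed.

Lemma orbit3_form3 Omega Psi : form3 R Omega -> orbit3 Omega Psi -> form3 R Psi.
Proof. by move=> h [f _ <-]; exact: form3_act. Qed.

(** The pullback along the map that sends e_i to e_i + y e_j and fixes the other basis vectors,
    matching [elem_coefs]. *)
Definition elem_form (o : nat * nat * K) Omega : form := fun X Y Z =>
  let: (i, j, y) := o in
  Omega (X + (y * X (inord i) ord0) *: basis R j)
        (Y + (y * Y (inord i) ord0) *: basis R j)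
        (Z + (y * Z (inord i) ord0) *: basis R j).

(** The last condition says that the determinant of the move is nonzero. *)
Definition elem_ok (o : nat * nat * K) :=
  [&& (o.1.1 < 7)%N, (o.1.2 < 7)%N & 1 + o.2 * (o.1.1 == o.1.2)%:R != 0].

Lemma elem_ok_scale i x : (i < 7)%N -> x != 0 -> elem_ok (i, i, x - 1).
Proof. by move=> li nx; rewrite /elem_ok /= li eqxx mulr1 addrC subrK. Qed.

Lemma elem_ok_shear i j y : (i < 7)%N -> (j < 7)%N -> i != j -> elem_ok (i, j, y).
Proof.
by move=> li lj /negbTE nij; rewrite /elem_ok /= li lj nij mulr0 addr0 oner_neq0.
Qed.

Definition run_form (s : seq (nat * nat * K)) Omega : form :=
  foldl (fun Psi o => elem_form o Psi) Omega s.

Lemma elem_form_orbit o Omega : elem_ok o -> orbit3 Omega (elem_form o Omega).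
Proof.
move: o => [[i j] y] /and3P /= [li lj yn0].
pose d : 'M[K]_7 := delta_mx (inord j) (inord i).
pose h (z : K) : 'M[K]_7 := 1%:M + z *: d.
have dd : d *m d = (i == j)%:R *: d.
  rewrite /d mul_delta_mx_cond -(inj_eq val_inj) /= !inordK //.
  by case: (i == j); rewrite ?scale1r ?scale0r.
(* Since d^2 is d or 0, the inverse of [h y] is again of the form [h z]. *)
have hh : h y *m h (- y / (1 + y * (i == j)%:R)) = 1%:M.
  rewrite /h mulmxDl mul1mx mulmxDr mulmx1.
  rewrite -scalemxAl -scalemxAr dd !scalerA -addrA -!scalerDl.
  rewrite [X in X *: d](_ : _ = 0) ?scale0r ?addr0 //.
  by field.
have [uh _] := mulmx1_unit hh.
(* [act] precomposes with the inverse, so the matrix is inverted once more. *)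
exists (invmx (h y)); first by rewrite /= unitmx_inv.
have hE X : h y *m X = X + (y * X (inord i) ord0) *: basis R j.
  rewrite /h mulmxDl mul1mx -scalemxAl -scalerA; congr (_ + _ *: _).
  apply/matrixP => a b; rewrite ord1 !mxE (bigD1 (inord i)) //= big1 ?addr0.
    by rewrite !mxE !eqxx ?andbT mulrC.
  by move=> k /negbTE nk; rewrite !mxE nk andbF mul0r.
apply: form_funext => X Y Z.
by rewrite /act invmxK !hE.
Qed.

Lemma run_form_orbit s Omega : all elem_ok s -> orbit3 Omega (run_form s Omega).
Proof.
elim: s Omega => [|o s ih] Omega /=; first by move=> _; exact: orbit3_refl.
case/andP => ok oks; apply: orbit3_trans (ih _ oks).
exact: elem_form_orbit.
Qed.

Lemma coef_elem_form i j y Omega a b d : form3 R Omega ->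
  (i < 7)%N -> (a < 7)%N -> (b < 7)%N -> (d < 7)%N ->
  coef (elem_form (i, j, y) Omega) a b d = elem_coefs (i, j, y) (coef Omega) a b d.
Proof.
move=> h li la lb ld; rewrite /elem_form /coef /elem_coefs /subst_index.
have basisE c : (c < 7)%N -> basis R c (inord i) ord0 = (eqn c i)%:R.
  by move=> lc; rewrite mxE eqxx andbT -(inj_eq val_inj) /= !inordK // eq_sym.
have E c : (c < 7)%N -> basis R c + (y * basis R c (inord i) ord0) *: basis R j =
   basis R c + (if eqn c i then y else 0) *: basis R j.
  by move=> lc; rewrite basisE //; case: eqn; rewrite ?mulr1 ?mulr0.
rewrite !E // (form3_lin1 _ _ _ _ _ h) !(form3_lin2 _ _ _ _ _ h).
rewrite !(form3_lin3 _ _ _ _ _ h).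
by do 3 case: eqn; rewrite ?mul0r ?addr0.
Qed.

Lemma eq_elem_coefs (F : numFieldType) (o : nat * nat * F) (w w' : coefs F) :
  (o.1.2 < 7)%N ->
  (forall a b d, (a < 7)%N -> (b < 7)%N -> (d < 7)%N -> w a b d = w' a b d) ->
  forall a b d, (a < 7)%N -> (b < 7)%N -> (d < 7)%N ->
    elem_coefs o w a b d = elem_coefs o w' a b d.
Proof.
move: o => [[i j] y] /= lj e a b d la lb ld; rewrite /subst_index.
by do 3 case: eqn; rewrite !e.
Qed.

Lemma eq_run_coefs (F : numFieldType) (s : seq (nat * nat * F)) (w w' : coefs F) :
  all (fun o => o.1.2 < 7)%N s ->
  (forall a b d, (a < 7)%N -> (b < 7)%N -> (d < 7)%N -> w a b d = w' a b d) ->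
  forall a b d, (a < 7)%N -> (b < 7)%N -> (d < 7)%N ->
    run_coefs s w a b d = run_coefs s w' a b d.
Proof.
elim: s w w' => [|o s ih] w w' //= /andP[lo ls] e.
by apply: ih => //; exact: eq_elem_coefs.
Qed.

Lemma coef_run_form s Omega : form3 R Omega -> all elem_ok s ->
  forall a b d, (a < 7)%N -> (b < 7)%N -> (d < 7)%N ->
  coef (run_form s Omega) a b d = run_coefs s (coef Omega) a b d.
Proof.
elim: s Omega => [|[[i j] y] s ih] Omega //= h /andP[oko oks] a b d la lb ld.
rewrite ih //; last by apply: orbit3_form3 (elem_form_orbit _ oko).
have /and3P[/= li _ _] := oko.
apply: eq_run_coefs => //; first by apply: sub_all oks => o' /and3P[].
by move=> *; apply: coef_elem_form.
Qed.

Lemma eq_slice (F : numFieldType) phi T (w w' : coefs F) :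
  all (fun t => [&& t.1.1 < 7, t.1.2 < 7 & t.2 < 7])%N T ->
  (forall a b d, (a < 7)%N -> (b < 7)%N -> (d < 7)%N -> w a b d = w' a b d) ->
  slice phi T w -> slice phi T w'.
Proof.
move=> + e; elim: T => //= t T ih /andP[/and3P[la lb ld] lT] [et eT].
by split; [rewrite -e | apply: ih].
Qed.
End Orbits.

Lemma cvg_arrow (T I : Type) (U : topologicalType) (F : set_system T)
    (FF : Filter F) (G : T -> I -> U) (g : I -> U) :
  (forall i, (fun t => G t i) @ F --> g i) -> G @ F --> g.
Proof.
move=> h; apply/cvg_sup => i A [B] [[W] oW <-] Wg WA.
apply: (filterS WA); apply: h.
exact: open_nbhs_nbhs.
Qed.

(** * Increasing triples and the two model forms *)

Definition sorted7 (t : nat * nat * nat) := (t.1.1 < t.1.2 < t.2)%N && (t.2 < 7)%N.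

Lemma mem_all_triples t : sorted7 t -> t \in all_triples.
Proof.
case: t => [[a b] d] /andP[/andP[/= ab bd] d7].
have b7 := ltn_trans bd d7; have a7 := ltn_trans ab b7.
case: a a7 ab => [|[|[|[|[|[|[|a]]]]]]] //= _;
  case: b b7 bd => [|[|[|[|[|[|[|b]]]]]]] //= _;
  by case: d d7 => [|[|[|[|[|[|[|d]]]]]]].
Qed.

Lemma slice_mem (F : numFieldType) (phi w : coefs F) T a b d :
  slice phi T w -> (a, b, d) \in T -> w a b d = phi a b d.
Proof.
elim: T => //= t T ih [et eT]; rewrite inE => /orP[/eqP e|]; last exact: ih.
by rewrite -e in et.
Qed.

Lemma slice_all_ext (F : numFieldType) (w w' : coefs F) :
  alt_coefs w -> alt_coefs w' -> slice w' all_triples w ->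
  forall a b d, (a < 7)%N -> (b < 7)%N -> (d < 7)%N -> w a b d = w' a b d.
Proof.
move=> [A12 A23 A0 A1] [B12 B23 B0 B1] h.
have sorted a b d : (a < b)%N -> (b < d)%N -> (d < 7)%N -> w a b d = w' a b d.
  move=> ab bd d7; apply: slice_mem h _.
  by rewrite mem_all_triples // /sorted7 /= ab bd.
have half a b d : (a < b)%N -> (a < 7)%N -> (b < 7)%N -> (d < 7)%N ->
    w a b d = w' a b d.
  move=> ab a7 b7 d7; case: (ltngtP b d) => [bd|db|<-]; first exact: sorted.
    rewrite A23 B23; congr (- _).
    case: (ltngtP a d) => [ad|da|<-]; first exact: sorted.
      by rewrite A12 B12; congr (- _); apply: sorted.
    by rewrite A0 B0.
  by rewrite A1 B1.
move=> a b d a7 b7 d7; case: (ltngtP a b) => [ab|ba|<-]; first exact: half.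
  by rewrite A12 B12; congr (- _); apply: half.
by rewrite A0 B0.
Qed.

(** The coefficients of e^ijk, in the shape of [wedge3E] so that [coef_wedge] holds by rewriting. *)
Definition wedge_coefs (F : numFieldType) (i j k : nat) : coefs F := fun a b d =>
  (eqn i a)%:R * ((eqn j b)%:R * (eqn k d)%:R - (eqn j d)%:R * (eqn k b)%:R)
  - (eqn i b)%:R * ((eqn j a)%:R * (eqn k d)%:R - (eqn j d)%:R * (eqn k a)%:R)
  + (eqn i d)%:R * ((eqn j a)%:R * (eqn k b)%:R - (eqn j b)%:R * (eqn k a)%:R).

Lemma phi0_wedge (F : numFieldType) : slice (@phi0 F) all_triples (fun a b d =>
  wedge_coefs F 0 1 4 a b d + 1 * wedge_coefs F 0 2 5 a b d
  + 1 * wedge_coefs F 0 3 6 a b d + 1 * wedge_coefs F 1 2 3 a b d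
  + 1 * wedge_coefs F 1 5 6 a b d + (-1) * wedge_coefs F 2 4 6 a b d
  + 1 * wedge_coefs F 3 4 5 a b d).
Proof.
rewrite /slice /wedge_coefs /=.
by repeat split; ring.
Qed.

Lemma split_wedge (F : numFieldType) : 
  slice (split_coefs (-2) (-4) 4) all_triples (fun a b d =>
  wedge_coefs F 0 1 4 a b d + (-3) * wedge_coefs F 0 1 4 a b d
  + (-2) * wedge_coefs F 0 2 5 a b d + (-2) * wedge_coefs F 0 3 6 a b d
  + (-4) * wedge_coefs F 1 2 3 a b d + 4 * wedge_coefs F 4 5 6 a b d).
Proof.
rewrite /slice /wedge_coefs /=.
by repeat split; ring.
Qed.

Section Models.
Variable R : realType.
Local Notation K := R[i].
Local Notation C := (R[i]^o).
Local Notation V := 'cV[R[i]]_7.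
Local Notation form := (V -> V -> V -> C).
Implicit Types Omega Psi : form.

Definition coord (k : nat) : V -> C := fun X => X (inord k) ord0.

Lemma coord_linear k : linear (coord k).
Proof. by move=> a X Y; rewrite /coord !mxE. Qed.

Lemma coord_basis k a : (a < 7)%N -> (k < 7)%N ->
  coord k (basis R a) = (eqn k a)%:R.
Proof.
by move=> la lk; rewrite /coord mxE eqxx andbT -(inj_eq val_inj) /= !inordK.
Qed.

Lemma form3_ext_slice Omega Psi : form3 R Omega -> form3 R Psi ->
  slice (coef Psi) all_triples (coef Omega) -> Omega = Psi.
Proof.
move=> h h' e; apply: form3_ext => //.
by apply: slice_all_ext => //; apply: coef_alt.
Qed.

Definition Phi0 : form := fun X Y Z =>
  wedge3 (coord 0) (coord 1) (coord 4) X Y Z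
  + 1 * wedge3 (coord 0) (coord 2) (coord 5) X Y Z
  + 1 * wedge3 (coord 0) (coord 3) (coord 6) X Y Z
  + 1 * wedge3 (coord 1) (coord 2) (coord 3) X Y Z
  + 1 * wedge3 (coord 1) (coord 5) (coord 6) X Y Z
  + (-1) * wedge3 (coord 2) (coord 4) (coord 6) X Y Z
  + 1 * wedge3 (coord 3) (coord 4) (coord 5) X Y Z.

Lemma form3_Phi0 : form3 R Phi0.
Proof.
by rewrite /Phi0; repeat apply: form3_comb; apply: form3_wedge; exact: coord_linear.
Qed.

(* The summand e^014 is split since form3_comb has no scalar in front of its
   first form. *)
Lemma Omega0E : Omega0 R = fun X Y Z =>
  wedge3 (coord 0) (coord 1) (coord 4) X Y Z
  + (-3) * wedge3 (coord 0) (coord 1) (coord 4) X Y Z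
  + (-2) * wedge3 (coord 0) (coord 2) (coord 5) X Y Z
  + (-2) * wedge3 (coord 0) (coord 3) (coord 6) X Y Z
  + (-4) * wedge3 (coord 1) (coord 2) (coord 3) X Y Z
  + 4 * wedge3 (coord 4) (coord 5) (coord 6) X Y Z.
Proof.
apply: form_funext => X Y Z.
rewrite /Omega0 -[@dualE R]/coord -[@dualF R 1]/(coord 4) -[@dualF R 2]/(coord 5).
by rewrite -[@dualF R 3]/(coord 6); ring.
Qed.

Lemma form3_Omega0 : form3 R (Omega0 R).
Proof.
rewrite Omega0E.
by repeat apply: form3_comb; apply: form3_wedge; exact: coord_linear.
Qed.

Lemma coef_wedge i j k a b d : (i < 7)%N -> (j < 7)%N -> (k < 7)%N ->
  (a < 7)%N -> (b < 7)%N -> (d < 7)%N ->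
  coef (wedge3 (coord i) (coord j) (coord k)) a b d = wedge_coefs K i j k a b d.
Proof. by move=> *; rewrite /coef wedge3E !coord_basis. Qed.

Lemma slice_Phi0 : slice (@phi0 K) all_triples (coef Phi0).
Proof.
apply: eq_slice (phi0_wedge K); first by [].
by move=> a b d la lb ld; rewrite -!coef_wedge.
Qed.

Lemma slice_Omega0 : slice (split_coefs (-2) (-4) 4) all_triples (coef (Omega0 R)).
Proof.
apply: eq_slice (split_wedge K); first by [].
by move=> a b d la lb ld; rewrite -!coef_wedge // Omega0E.
Qed.
End Models.

(** * Forms near Phi0 and forms with an open orbit *)

Section Reduction.
Variable R : realType.
Local Notation K := R[i].
Local Notation C := (R[i]^o).
Local Notation V := 'cV[R[i]]_7.
Local Notation form := (V -> V -> V -> C).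
Local Notation phi0 := (@phi0 K).
Local Notation Phi0 := (@Phi0 R).
Implicit Types Omega Psi : form.

Lemma cvg_form (T : Type) (F : set_system T) (FF : Filter F) (G : T -> form) Psi :
  (forall X Y Z, (fun t => G t X Y Z) @ F --> Psi X Y Z) -> G @ F --> Psi.
Proof.
move=> h.
have h2 X Y : (fun t => G t X Y) @ F --> Psi X Y by apply: cvg_arrow => Z; apply: h.
have h1 X : (fun t => G t X) @ F --> Psi X by apply: cvg_arrow => Y; apply: h2.
by apply: cvg_arrow => X; apply: h1.
Qed.

Lemma eval_form_continuous X Y Z : continuous (fun Omega : form => Omega X Y Z).
Proof.
move=> Psi.
have e1 : (fun Omega : form => Omega X) @ Psi --> Psi X.
  exact: (@proj_continuous V (fun=> _) X Psi).
have e2 : (fun Omega : form => Omega X Y) @ Psi --> Psi X Y.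
  apply: (@cvg_comp _ _ _ _ (fun g : V -> V -> C => g Y) _ _ _ e1).
  exact: (@proj_continuous V (fun=> _) Y (Psi X)).
apply: (@cvg_comp _ _ _ _ (fun g : V -> C => g Z) _ _ _ e2).
exact: (@proj_continuous V (fun=> _) Z (Psi X Y)).
Qed.

(** Neighbourhoods among the 3-forms only, since the ambient space consists of all functions. *)
Definition near_Phi0 : set_system form := within (form3 R) (nbhs Phi0).

Global Instance near_Phi0_filter : Filter near_Phi0.
Proof. exact: within_filter. Qed.

Lemma cvg_eval X Y Z : (fun Omega : form => Omega X Y Z) @ near_Phi0 --> Phi0 X Y Z.
Proof. by apply: cvg_within_filter; exact: eval_form_continuous. Qed.

Lemma coef_Phi0 a b d : sorted7 (a, b, d) -> coef Phi0 a b d = phi0 a b d.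
Proof. by move=> s; apply: slice_mem (slice_Phi0 R) _; exact: mem_all_triples. Qed.

(** The limit uses the table [phi0], which agrees with [coef Phi0] on increasing triples and can be
    computed. *)
Definition cont (x : coefs K -> K) : Prop :=
  (fun Omega => x (coef Omega) : C) @ near_Phi0 --> (x phi0 : C).

Lemma cont_coef a b d : sorted7 (a, b, d) -> cont (fun w => w a b d).
Proof. by move=> s; rewrite /cont -coef_Phi0 //; exact: cvg_eval. Qed.

Lemma contD x y : cont x -> cont y -> cont (fun w => x w + y w).
Proof. by rewrite /cont => hx hy; have := cvgD hx hy; apply. Qed.

Lemma contN x : cont x -> cont (fun w => - x w).
Proof. by rewrite /cont => hx; have := cvgN hx; apply. Qed.

Lemma contM x y : cont x -> cont y -> cont (fun w => x w * y w).
Proof. by rewrite /cont => hx hy; have := cvgM hx hy; apply. Qed.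

Lemma contV x : x phi0 != 0 -> cont x -> cont (fun w => (x w)^-1).
Proof. by move=> x0 hx; exact: cvgV. Qed.

Lemma cont_cst c : cont (fun=> c).
Proof. exact: cvg_cst. Qed.

(** The arguments of [G Omega] vary with Omega, but trilinearity reduces to evaluations at fixed
    vectors: terms with e_j twice vanish, and the three with e_j once carry the factor [y Omega],
    which tends to 0. So pointwise convergence suffices. *)
Lemma cvg_elem_form (i j : nat) (y : form -> K) (G : form -> form) :
  (\forall Omega \near near_Phi0, form3 R (G Omega)) ->
  (y : form -> C) @ near_Phi0 --> (0 : C) -> G @ near_Phi0 --> Phi0 ->
  (fun Omega => elem_form (i, j, y Omega) (G Omega)) @ near_Phi0 --> Phi0.
Proof.
move=> hG hy hGP; apply: cvg_form => X Y Z.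
have ev X' Y' Z' : (fun Omega => G Omega X' Y' Z') @ near_Phi0 --> Phi0 X' Y' Z'.
  apply: (@cvg_comp _ _ _ _ (fun Psi : form => Psi X' Y' Z') _ _ _ hGP).
  exact: eval_form_continuous.
pose c (X : V) := X (inord i) ord0.
pose e := basis R j.
have term (a : K) X' Y' Z' :
    (fun Omega => (y Omega * a) * G Omega X' Y' Z' : C) @ near_Phi0 --> (0 : C).
  rewrite -(mul0r (Phi0 X' Y' Z')) -{1}(mul0r a).
  exact: (cvgM (cvgM hy (cvg_cst _)) (ev _ _ _)).
have FF := near_Phi0_filter.
have lim := cvgD (cvgD (cvgD (ev X Y Z) (term (c X) e Y Z))
  (term (c Y) X e Z)) (term (c Z) X Y e).
move: lim => /(_ FF FF FF); rewrite !addr0 => lim.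
apply: cvg_trans lim; apply: near_eq_cvg.
move: hG; apply: filterS => Omega h; rewrite /elem_form.
rewrite (form3_lin1 _ _ _ _ _ h) !(form3_lin2 _ _ _ _ _ h).
rewrite !(form3_lin3 _ _ _ _ _ h).
have [-> _ _] := form3_diag e Z h; have [-> _ _] := form3_diag e e h.
have [_ _ ->] := form3_diag e Y h; have [_ -> _] := form3_diag X e h.
rewrite !mulr0 !addr0 -/e.
transitivity (G Omega X Y Z + y Omega * c X * G Omega e Y Z
  + y Omega * c Y * G Omega X e Z + y Omega * c Z * G Omega X Y e) => //.
by rewrite /c; ring.
Qed.

(** This makes a stage continuous at Phi0 and makes it fix Phi0. *)
Definition vanishing (L : seq (nat * nat * (coefs K -> K))) : Prop :=
  foldr (fun o P => [/\ cont o.2, o.2 phi0 = 0 & P]) True L.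

(** Induction on [L], with [G] the moves made so far while the scalars remain functions of the
    initial Omega. Where [p] is nonzero the moves are invertible, so [G Omega] stays a 3-form. *)
Lemma cvg_run_form (L : seq (nat * nat * (coefs K -> K))) (p : coefs K -> K)
    (G : form -> form) :
  (\forall Omega \near near_Phi0, p (coef Omega) != 0) ->
  (forall w, p w != 0 -> all (@elem_ok R) (ops_at L w)) ->
  vanishing L ->
  (\forall Omega \near near_Phi0, form3 R (G Omega)) -> G @ near_Phi0 --> Phi0 ->
  (fun Omega => run_form (ops_at L (coef Omega)) (G Omega)) @ near_Phi0 --> Phi0.
Proof.
move=> hp; elim: L G => [|[[i j] x] L ih] G //= hok [cx x0 hL] hG GP.
apply: (ih (fun Omega => elem_form (i, j, x (coef Omega)) (G Omega))).
- by move=> w pw; have /andP[] := hok w pw.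
- exact: hL.
- apply: filterS2 hp hG => Omega pw h.
  have /andP[ok _] := hok _ pw.
  by apply: orbit3_form3 h _; exact: elem_form_orbit.
- have y0 : (fun Omega => x (coef Omega) : C) @ near_Phi0 --> (0 : C).
    by move: cx; rewrite /cont x0.
  exact: cvg_elem_form hG y0 GP.
Qed.

(** * Moving along the line from Omega (t = 0) to Phi0 (t = 1) *)

Definition line Omega (t : K) : form := fun X Y Z =>
  Omega X Y Z + t * (Phi0 X Y Z + (-1) * Omega X Y Z).

Lemma form3_line Omega t : form3 R Omega -> form3 R (line Omega t).
Proof. by move=> h; do 2 apply: form3_comb => //; exact: form3_Phi0. Qed.

(** A pivot that is polynomial along the line and nonzero at its end Phi0 has finitely many zeros on
    it. *)
Definition poly_along (p : coefs K -> K) := forall Omega,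
  exists q : {poly K}, forall t, p (coef (line Omega t)) = q.[t].

Lemma poly_along_coef a b d : poly_along (fun w => w a b d).
Proof.
move=> Omega; exists ((coef Omega a b d)%:P +
  (coef Phi0 a b d - coef Omega a b d) *: 'X) => t.
by rewrite !hornerE /coef /line; ring.
Qed.

Lemma poly_along_cst c : poly_along (fun=> c).
Proof. by move=> Omega; exists c%:P => t; rewrite hornerC. Qed.

Lemma poly_alongD x y : poly_along x -> poly_along y ->
  poly_along (fun w => x w + y w).
Proof.
move=> hx hy Omega; have [q e] := hx Omega; have [q' e'] := hy Omega.
by exists (q + q') => t; rewrite hornerD e e'.
Qed.

Lemma poly_alongM x y : poly_along x -> poly_along y ->
  poly_along (fun w => x w * y w).
Proof.
move=> hx hy Omega; have [q e] := hx Omega; have [q' e'] := hy Omega.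
by exists (q * q') => t; rewrite hornerM e e'.
Qed.

Definition in_slice T Omega := slice phi0 T (coef Omega).

(** A slice is cut out by affine equations that Phi0 satisfies. *)
Lemma in_slice_line T Omega t : all sorted7 T -> in_slice T Omega ->
  in_slice T (line Omega t).
Proof.
rewrite /in_slice; elim: T => //= u T ih /andP[su sT] [eu eT].
split; last exact: ih.
have := @coef_Phi0 u.1.1 u.1.2 u.2; case: u su eu => [[a b] d] /= su eu /(_ su).
by rewrite /coef /line => e; rewrite e; rewrite /coef in eu; rewrite eu; ring.
Qed.

Lemma small_nonroot (q : {poly K}) (e : K) : q != 0 -> 0 < e ->
  exists2 t, `|t| < e & q.[t] != 0.
Proof.
(* The [size q] points e / 2, e / 3, ... have modulus less than e, and they outnumber the roots of
   [q]. *)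
move=> q0 e0; pose s := [seq e / (k.+2)%:R | k <- iota 0 (size q)].
have us : uniq s.
  rewrite map_inj_uniq ?iota_uniq // => k l /(mulfI (lt0r_neq0 e0)) /invr_inj /eqP.
  by rewrite eqr_nat => /eqP[].
case: (boolP (all (root q) s)) => [h|/allPn[t ts rt]].
  by have := max_poly_roots q0 h us; rewrite size_map size_iota ltnn.
exists t => //; case/mapP: ts => k _ ->.
by rewrite gtr0_norm ?divr_gt0 // ltr_pdivrMr // ltr_pMr // ltr1n.
Qed.

(** For small t the line stays in the open orbit, while [p] vanishes at finitely many t only. *)
Lemma generic_perturb p Omega :
  poly_along p -> p (coef Phi0) != 0 -> generic3 R Omega ->
  exists t, orbit3 Omega (line Omega t) /\ p (coef (line Omega t)) != 0.
Proof.
move=> hp p0 [h oO].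
have nO : within (form3 R) (nbhs Omega) (orbit3 Omega).
  have : nbhs (Omega : subspace (form3 R)) (orbit3 Omega).
    by apply: open_nbhs_nbhs; split=> //; exact: orbit3_refl.
  by rewrite nbhs_subspace_in.
have lc : (line Omega : C -> form) @ (0 : C) --> Omega.
  have FF : Filter (nbhs (0 : C)) := nbhs_filter _.
  apply: (@cvg_form _ _ FF) => X Y Z.
  have c1 : (fun t : C => t) @ (0 : C) --> (0 : C) by exact: cvg_id.
  have := cvgD (cvg_cst (Omega X Y Z))
    (cvgM c1 (cvg_cst (Phi0 X Y Z + (-1) * Omega X Y Z : C))).
  by rewrite mul0r addr0; apply.
have /lc : nbhs Omega [set Psi | form3 R Psi -> orbit3 Omega Psi] by [].
move=> /nbhs_ballP[e /= e0 he].
have [q hq] := hp Omega.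
have q0 : q != 0.
  apply/negP => /eqP q0; move: (hq 1); rewrite q0 horner0 => e1; move: p0.
  rewrite -e1 (_ : line Omega 1 = Phi0) ?eqxx //.
  by apply: form_funext => X Y Z; rewrite /line; ring.
have [t te qt] := small_nonroot q0 e0.
exists t; split; last by rewrite hq.
apply: he; last exact: form3_line.
by rewrite -ball_normE /= sub0r normrN.
Qed.
End Reduction.

Lemma slice_transfer (F : numFieldType) (phi w w' : coefs F) T :
  slice phi T w -> slice phi T w' -> slice w T w'.
Proof. by elim: T => //= t T ih [<- h] [<- h']; split=> //; exact: ih. Qed.

(** * Backward induction along the slices *)

Section Main.
Variable R : realType.
Local Notation K := R[i].
Local Notation C := (R[i]^o).
Local Notation V := 'cV[R[i]]_7.
Local Notation form := (V -> V -> V -> C).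
Local Notation phi0 := (@phi0 K).
Local Notation Phi0 := (@Phi0 R).
Local Notation Omega0 := (Omega0 R).
Local Notation near_Phi0 := (@near_Phi0 R).
Implicit Types Omega Psi : form.

Lemma generic3_orbit Omega Psi : generic3 R Omega -> orbit3 Omega Psi ->
  generic3 R Psi.
Proof.
move=> [h o] OP; split; first exact: orbit3_form3 OP.
by rewrite -(orbit3_eq OP).
Qed.

Lemma cont_neq0 (p : coefs K -> K) : cont p -> p phi0 != 0 ->
  \forall Omega \near near_Phi0, p (coef Omega) != 0.
Proof. exact: cvgr_neq0. Qed.

(** For the empty slice, the first half gives the openness of the orbit of Omega0 and the second its
    uniqueness among open orbits. *)
Definition reducible T :=
  (\forall Omega \near near_Phi0, in_slice T Omega -> orbit3 Omega0 Omega) /\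
  (forall Omega, generic3 R Omega -> in_slice T Omega -> orbit3 Omega0 Omega).

Lemma near_form3 : \forall Omega \near near_Phi0, form3 R Omega.
Proof. exact: withinT. Qed.

(** One may assume the pivot nonzero: near Phi0 by continuity, and for a generic form after a move
    along the line inside its orbit and slice. *)
Lemma reducible_of_slice T p : all sorted7 T ->
  poly_along p -> cont p -> p phi0 != 0 -> p (coef Phi0) = p phi0 ->
  (\forall Omega \near near_Phi0, p (coef Omega) != 0 ->
     in_slice T Omega -> orbit3 Omega0 Omega) ->
  (forall Omega, generic3 R Omega -> p (coef Omega) != 0 ->
     in_slice T Omega -> orbit3 Omega0 Omega) ->
  reducible T.
Proof.
move=> sT pp cp p0 pE hn hg; split.
  by apply: filterS2 hn (cont_neq0 cp p0) => Omega + pn; exact.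
move=> Omega gO sO; have [|t [ot pt]] := generic_perturb pp _ gO.
  by rewrite pE.
apply: orbit3_trans (orbit3_sym ot); apply: hg => //.
  exact: generic3_orbit ot.
exact: in_slice_line.
Qed.

(** The stage [L] stays in the orbit and leads from [T] to [T']. Near Phi0 its result tends to Phi0,
    so the local half for [T'] applies to it; for generic forms genericity passes along the
    orbit. *)
Lemma reducible_step T T' p L : all sorted7 T -> all sorted7 T' ->
  poly_along p -> cont p -> p phi0 != 0 -> p (coef Phi0) = p phi0 ->
  (forall w, p w != 0 -> all (@elem_ok R) (ops_at L w)) ->
  vanishing L ->
  (forall w, p w != 0 -> alt_coefs w -> slice phi0 T w ->
     slice phi0 T' (run_coefs (ops_at L w) w)) ->
  reducible T' -> reducible T.
Proof.
move=> sT sT' pp cp p0 pE ok Lc step [rn rg].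
have stepF Omega : form3 R Omega -> p (coef Omega) != 0 -> in_slice T Omega ->
    in_slice T' (run_form (ops_at L (coef Omega)) Omega).
  move=> h pn sO; 
  apply: (@eq_slice K _ _ (run_coefs (ops_at L (coef Omega)) (coef Omega))).
  - apply: sub_all sT' => t /andP[/andP[ab bd] d7]; rewrite d7.
    by rewrite (ltn_trans bd d7) (ltn_trans ab (ltn_trans bd d7)).
  - by move=> a b d la lb ld; rewrite coef_run_form // ok.
  - by apply: step => //; exact: coef_alt.
apply: (@reducible_of_slice T p) => //.
  have lim := cvg_run_form (cont_neq0 cp p0) ok Lc near_form3 (G := id).
  have /lim : near_Phi0 --> Phi0 by exact: cvg_within.
  move=> {}lim.
  have : \forall Omega \near near_Phi0,
     form3 R (run_form (ops_at L (coef Omega)) Omega) ->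
     in_slice T' (run_form (ops_at L (coef Omega)) Omega) ->
     orbit3 Omega0 (run_form (ops_at L (coef Omega)) Omega).
    exact: (lim _ rn).
  move=> nr; apply: filterS2 nr near_form3 => Omega nr h pn sO.
  have o := run_form_orbit Omega (ok _ pn).
  apply: orbit3_trans (orbit3_sym o); apply: nr; last exact: stepF.
  exact: orbit3_form3 o.
move=> Omega gO pn sO.
have o := run_form_orbit Omega (ok _ pn).
apply: orbit3_trans (orbit3_sym o); apply: rg; first exact: generic3_orbit o.
by apply: stepF => //; case: gO.
Qed.
End Main.

(** * The reduction *)

Section Final.
Variable R : realType.
Local Notation K := R[i].
Local Notation C := (R[i]^o).
Local Notation V := 'cV[R[i]]_7.
Local Notation form := (V -> V -> V -> C).
Local Notation phi0 := (@phi0 K).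
Local Notation Phi0 := (@Phi0 R).
Local Notation Omega0 := (Omega0 R).
Implicit Types Omega Psi : form.

Lemma orbit_of_roots Omega (r1 r2 r3 s t : K) : form3 R Omega ->
  r1 != 0 -> r2 != 0 -> r3 != 0 -> t != 0 -> s != 0 -> s != t ->
  s * t = - (r1 * r2 * r3) ^+ 2 ->
  in_slice fixed9 Omega ->
  coef Omega 1 5 6 = r1 ^+ 2 -> coef Omega 2 4 6 = - r2 ^+ 2 ->
  coef Omega 3 4 5 = r3 ^+ 2 -> coef Omega 4 5 6 = s + t ->
  orbit3 Omega0 Omega.
Proof.
move=> h n1 n2 n3 nt ns nst st sO q1 q2 q3 q4.
have sE : s = - (r1 * r2 * r3) ^+ 2 / t by rewrite -st mulfK.
have ts : t - s != 0 by rewrite subr_eq0 eq_sym.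
pose y := t * (t - s) ^+ 2 / (r1 * r2 * r3).
pose z := s * (t - s) ^+ 2 / (r1 * r2 * r3).
have y0 : y != 0 by rewrite /y !mulf_neq0 ?invr_eq0 ?mulf_neq0.
have z0 : z != 0 by rewrite /z !mulf_neq0 ?invr_eq0 ?mulf_neq0.
have ok : all (@elem_ok R) (split_ops r1 r2 r3 s t).
  (* This factor scales the F_i in [split_ops]; it is nonzero because s and t differ. *)
  have nu : 1 - s / t != 0 by rewrite -{1}(mulfV nt) -mulrBl mulf_neq0 ?invr_eq0.
  by rewrite /= !elem_ok_scale ?elem_ok_shear ?mulf_neq0 ?invr_eq0 ?oppr_eq0.
have step := step_split n1 n2 n3 nt sE (coef_alt h)
  (conj sO (conj q1 (conj q2 (conj q3 q4)))).
pose Psi := run_form (split_ops r1 r2 r3 s t) Omega.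
have oPsi : orbit3 Omega Psi by exact: run_form_orbit.
have hPsi : form3 R Psi by exact: orbit3_form3 oPsi.
have lt7 : all (fun u => [&& u.1.1 < 7, u.1.2 < 7 & u.2 < 7])%N all_triples by [].
have sPsi : slice (split_coefs (s - t) y z) all_triples (coef Psi).
  by apply: eq_slice step => // a b d la lb ld; rewrite coef_run_form.
(* Scaling the E_i by [c] and the F_i by [c'] turns the coefficients at e^123 and e^456 into -4 and
   4; scaling E_0 by [k] then turns s - t into -2. *)
pose c := 3.-root (- 4 / y); pose c' := 3.-root (4 / z).
have c3 : c ^+ 3 = - 4 / y by rewrite rootCK.
have c'3 : c' ^+ 3 = 4 / z by rewrite rootCK.
have n4 : (4 : K) != 0 by rewrite pnatr_eq0.
have nc : c != 0.
  have : c ^+ 3 != 0 by rewrite c3 !mulf_neq0 ?invr_eq0 ?oppr_eq0.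
  by rewrite expf_eq0.
have nc' : c' != 0.
  have : c' ^+ 3 != 0 by rewrite c'3 !mulf_neq0 ?invr_eq0.
  by rewrite expf_eq0.
pose k := - 2 / (c * c' * (s - t)).
have nk : k != 0.
  by rewrite mulf_neq0 ?invr_eq0 ?oppr_eq0 ?pnatr_eq0 // !mulf_neq0 // subr_eq0.
have okk : all (@elem_ok R) (scale_ops k c c').
  by rewrite /= !elem_ok_scale.
pose Xi := run_form (scale_ops k c c') Psi.
have oXi : orbit3 Psi Xi by exact: run_form_orbit.
have hXi : form3 R Xi by exact: orbit3_form3 oXi.
have sXi : slice (split_coefs (-2) (-4) 4) all_triples (coef Xi).
  have := step_scale k c c' (coef_alt hPsi) sPsi.
  have -> : k * c * c' * (s - t) = -2.
    by rewrite /k; field; rewrite ?nc ?nc' ?subr_eq0 ?nst.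
  rewrite c3 c'3 (divfK y0) (divfK z0) => e.
  by apply: eq_slice e => // a b d la lb ld; rewrite coef_run_form.
have <- : Xi = Omega0.
  apply: (form3_ext_slice hXi (form3_Omega0 R)).
  exact: (slice_transfer (slice_Omega0 R) sXi).
exact: orbit3_sym (orbit3_trans oPsi oXi).
Qed.

(* The second factor is d ^ 2 + 4 q_1 q_2 q_3, since w_246 = - q_2. *)
Definition final_pivot (w : coefs K) : K :=
  w _[1, 5, 6] * w _[2, 4, 6] * w _[3, 4, 5] *
  (w _[4, 5, 6] * w _[4, 5, 6] +
   -4 * (w _[1, 5, 6] * w _[2, 4, 6] * w _[3, 4, 5])).

Lemma orbit_of_final_pivot Omega : form3 R Omega -> final_pivot (coef Omega) != 0 ->
  in_slice fixed9 Omega -> orbit3 Omega0 Omega.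
Proof.
move=> h; rewrite /final_pivot; set q1 := coef _ 1 5 6; set q2 := coef _ 2 4 6.
set q3 := coef _ 3 4 5; set d := coef _ 4 5 6; set D := d * d + _.
rewrite !mulf_eq0 !negb_or -!andbA => /and4P[n1 n2 n3 nD] sO.
(* The roots of X^2 - d X + q1 q2 q3, of discriminant [D]. Here [q2] is w_246 itself, so r2 is a
   square root of - q2. *)
pose t := (d + sqrtC D) / 2; pose s := (d - sqrtC D) / 2.
have n2' : (2 : K) != 0 by rewrite pnatr_eq0.
have stE : s * t = q1 * q2 * q3.
  have -> : s * t = (d * d - sqrtC D ^+ 2) / 4 by rewrite /s /t; field.
  by rewrite sqrtCK /D; field.
have : s * t != 0 by rewrite stE !mulf_neq0.
rewrite mulf_eq0 negb_or => /andP[ns nt].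
apply: (@orbit_of_roots Omega (sqrtC q1) (sqrtC (- q2)) (sqrtC q3) s t) => //.
- by rewrite sqrtC_eq0.
- by rewrite sqrtC_eq0 oppr_eq0.
- by rewrite sqrtC_eq0.
- rewrite -subr_eq0 (_ : s - t = - sqrtC D); last by rewrite /s /t; field.
  by rewrite oppr_eq0 sqrtC_eq0.
- by rewrite !exprMn !sqrtCK stE; ring.
- by rewrite sqrtCK.
- by rewrite sqrtCK opprK.
- by rewrite sqrtCK.
- by rewrite -/d /s /t; field.
Qed.

Ltac cont_tac := lazymatch goal with
  | |- cont (fun w => @GRing.add _ (@?x w) (@?y w)) =>
      apply: (@contD _ x y); cont_tac
  | |- cont (fun w => @GRing.mul _ (@?x w) (@?y w)) =>
      apply: (@contM _ x y); cont_tac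
  | |- cont (fun w => @GRing.opp _ (@?x w)) => apply: (@contN _ x); cont_tac
  | |- cont (fun w => @GRing.inv _ (@?x w)) => apply: (@contV _ x);
      [by rewrite /= ?oppr_eq0 ?oner_neq0 ?pnatr_eq0 | cont_tac]
  | |- cont (fun w => w ?a ?b ?d) => exact: (@cont_coef _ a b d)
  | |- _ => exact: cont_cst
  end.
Ltac ops_cont := rewrite /vanishing /=; repeat split;
  lazymatch goal with
  | |- cont _ => cont_tac
  | |- _ => field; rewrite ?oner_neq0 ?pnatr_eq0 //
  end.
Ltac shears_ok := let w := fresh "w" in move=> w; rewrite /= ?elem_ok_shear.
Ltac ops_ok := let w := fresh "w" in let nz := fresh "nz" in
  move=> w nz; rewrite /= ?elem_ok_scale ?elem_ok_shear ?invr_eq0.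

Lemma reducible9 : @reducible R fixed9.
Proof.
apply: (@reducible_of_slice R fixed9 final_pivot) => //.
- by repeat first [apply: poly_along_cst | apply: poly_along_coef
    | apply: poly_alongD | apply: poly_alongM].
- by rewrite /final_pivot; cont_tac.
- have -> : final_pivot phi0 = -4 by rewrite /final_pivot /=; ring.
  by rewrite oppr_eq0 pnatr_eq0.
- by rewrite /final_pivot !coef_Phi0.
- by apply: filterS (@near_form3 R) => Omega h; exact: orbit_of_final_pivot.
- by move=> Omega [h _]; exact: orbit_of_final_pivot.
Qed.

Lemma reducible_coef a b d T T' L : sorted7 (a, b, d) -> phi0 a b d != 0 ->
  all sorted7 T -> all sorted7 T' ->
  (forall w : coefs K, w a b d != 0 -> all (@elem_ok R) (ops_at L w)) ->
  vanishing L ->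
  (forall w : coefs K, w a b d != 0 -> alt_coefs w -> slice phi0 T w ->
     slice phi0 T' (run_coefs (ops_at L w) w)) ->
  @reducible R T' -> @reducible R T.
Proof.
move=> sabd nz sT sT' ok Lc step.
apply: (@reducible_step R T T' (fun w => w a b d) L) => //.
- exact: poly_along_coef.
- exact: cont_coef.
- exact: coef_Phi0.
Qed.

Lemma reducible_cst T T' L : all sorted7 T -> all sorted7 T' ->
  (forall w : coefs K, all (@elem_ok R) (ops_at L w)) ->
  vanishing L ->
  (forall w : coefs K, alt_coefs w -> slice phi0 T w ->
     slice phi0 T' (run_coefs (ops_at L w) w)) ->
  @reducible R T' -> @reducible R T.
Proof.
move=> sT sT' ok Lc step; apply: (@reducible_step R T T' (fun=> 1) L) => //.
- exact: poly_along_cst.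
- exact: cont_cst.
- exact: oner_neq0.
- by move=> w _; exact: step.
Qed.

Lemma reducible_nil : @reducible R [::].
Proof.
have nz1 : (1 : K) != 0 := oner_neq0 _.
have nzN1 : (-1 : K) != 0 by rewrite oppr_eq0 oner_neq0.
apply: (@reducible_coef 0 1 4 _ fixed1 (moves1 K)) => //;
  [by ops_ok | by ops_cont | exact: (@step1 K) | ].
apply: (@reducible_cst _ fixed2 (moves2 K)) => //;
  [by shears_ok | by ops_cont | exact: (@step2 K) | ].
apply: (@reducible_coef 0 2 5 _ fixed3 (moves3 K)) => //;
  [by ops_ok | by ops_cont | exact: (@step3 K) | ].
apply: (@reducible_cst _ fixed4 (moves4 K)) => //;
  [by shears_ok | by ops_cont | exact: (@step4 K) | ].
apply: (@reducible_coef 0 3 6 _ fixed5 (moves5 K)) => //;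
  [by ops_ok | by ops_cont | exact: (@step5 K) | ].
apply: (@reducible_coef 1 2 3 _ fixed6 (moves6 K)) => //;
  [by ops_ok | by ops_cont | exact: (@step6 K) | ].
apply: (@reducible_cst _ fixed7 (moves7 K)) => //;
  [by shears_ok | by ops_cont | exact: (@step7 K) | ].
apply: (@reducible_coef 1 5 6 _ fixed8 (moves8 K)) => //;
  [by ops_ok | by ops_cont | exact: (@step8 K) | ].
apply: (@reducible_coef 2 4 6 _ fixed9 (moves9 K)) => //;
  [by ops_ok | by ops_cont | exact: (@step9 K) | ].
exact: reducible9.
Qed.

Lemma act_continuous (f : 'M[K]_7) : continuous (act f : form -> form).
Proof.
move=> Psi; have FF : Filter (nbhs Psi) := nbhs_filter _.
apply: (@cvg_form R _ _ FF) => X Y Z.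
exact: (@eval_form_continuous R (invmx f *m X) (invmx f *m Y) (invmx f *m Z) Psi).
Qed.

Lemma Phi0_orbit : orbit3 Omega0 Phi0.
Proof.
(* Phi0 lies in each of its neighbourhoods, so the local half applies to Phi0 itself. *)
have [n _] := reducible_nil.
by have /(_ (form3_Phi0 R) I) := nbhs_singleton n.
Qed.

Lemma open_subspace_within (T : topologicalType) (A U : set T) : U `<=` A ->
  (forall x, U x -> within A (nbhs x) U) -> open (U : set (subspace A)).
Proof.
move=> UA h; rewrite openE => x Ux.
by have := h x Ux; rewrite nbhs_subspace_in //; exact: UA.
Qed.

(** The orbit contains all forms near Phi0; a group element taking Omega to Phi0 acts continuously
    and carries this back to any Omega in the orbit. *)
Lemma generic3_Omega0 : generic3 R Omega0.
Proof.
split; first exact: form3_Omega0.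
apply: open_subspace_within => [Omega|Omega oO].
  exact: orbit3_form3 (form3_Omega0 R).
have [f /= uf fP] := orbit3_trans (orbit3_sym oO) Phi0_orbit.
have [n _] := reducible_nil.
have n' : nbhs Omega [set Psi | form3 R (act f Psi) ->
    in_slice [::] (act f Psi) -> orbit3 Omega0 (act f Psi)].
  by have := @act_continuous f Omega; rewrite /continuous_at fP => /(_ _ n).
rewrite /within; apply: filterS n' => Psi nP hPsi.
have o : orbit3 Psi (act f Psi) by exists f.
apply: orbit3_trans (orbit3_sym o).
by apply: nP => //; exact: form3_act.
Qed.
End Final.

Theorem theorem4p8 (R : realType) :
  generic3 R (Omega0 R) /\
  [set orbit3 Omega | Omega in generic3 R] = [set orbit3 (Omega0 R)].
Proof.
have g0 := generic3_Omega0 R; split => //.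
apply/seteqP; split => [_ [Omega gO <-]|_ ->]; last by exists (Omega0 R).
have [_ r] := reducible_nil R.
by rewrite /= -(orbit3_eq (r _ gO I)).
Qed.
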